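(* The bracket on $\mathbb K[gl(m)^*]$ $$\{f,g\}_r=\circ\,r_+^{\mathrm{l,r}}(f\otimes g)-\circ\,r_+^{\mathrm{r,l}}(f\otimes g)-\circ\,r_-^{\mathrm{ad,ad}}(f\otimes g),\qquad f,g\in\mathbb K[gl(m)^*],$$ is compatible with the linear Poisson-Lie bracket $\{\,,\}_{PL}$ of $gl(m)$ (their Schouten bracket vanishes) and, therefore, any bracket of the pencil $\{\,,\}_{PL,r}=a\,\{\,,\}_{PL}+b\,\{\,,\}_r$, $a,b\in\mathbb K$, is Poisson.
   Context: $\mathbb K=\mathbb C$ (or $\mathbb R$). $e_i^j$, $1\le i,j\le m$, is the standard basis of $gl(m)$: $[e_i^j,e_k^r]=\delta_k^j e_i^r-\delta_i^r e_k^j$. $\mathbb K[gl(m)^*]$ is the commutative polynomial algebra in the linear functions $l_i^j$, $1\le i,j\le m$, corresponding to the $e_i^j$. The Poisson-Lie bracket is $\{l_i^j,l_k^r\}_{PL}=\delta_k^jl_i^r-\delta_i^rl_k^j$. $\circ$ denotes the commutative pointwise product of functions. $gl(m)$ acts on $\mathbb K[gl(m)^*]$ by the left, right and adjoint vector fields $e_i^j\triangleright l_k^s=\delta_k^jl_i^s$, $l_k^s\triangleleft e_i^j=\delta_i^sl_k^j$, $\mathrm{ad}\,e_i^j(l_k^s)=e_i^j\triangleright l_k^s-l_k^s\triangleleft e_i^j$, extended to polynomials by the Leibniz rule. With $r_-=\sum_{i<j}(e_i^j\otimes e_j^i-e_j^i\otimes e_i^j)$ and $r_+=\sum_{i,j}e_i^j\otimes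 e_j^i$, $$r_-^{\mathrm{ad,ad}}(f\otimes g)=\sum_{i<j}\big(\mathrm{ad}\,e_i^j(f)\otimes\mathrm{ad}\,e_j^i(g)-\mathrm{ad}\,e_j^i(f)\otimes\mathrm{ad}\,e_i^j(g)\big),$$ $$r_+^{\mathrm{l,r}}(f\otimes g)=\sum_{i,j}(e_i^j\triangleright f)\otimes(g\triangleleft e_j^i),\qquad r_+^{\mathrm{r,l}}(f\otimes g)=\sum_{i,j}(f\triangleleft e_i^j)\otimes(e_j^i\triangleright g).$$ *)

(* Defs.v *)
From mathcomp Require Import all_boot all_order all_algebra.
From mathcomp Require Export mpoly.

Set Implicit Arguments.
Unset Strict Implicit.
Unset Printing Implicit Defensive.

Import GRing.Theory.
Local Open Scope ring_scope.

Record is_poisson (K : fieldType) (A : comAlgType K) (br : A -> A -> A) : Prop :=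
  IsPoisson {
    poisson_skew : forall f g, br f g = - br g f;
    poisson_linear : forall g (c : K) (f1 f2 : A),
      br (c *: f1 + f2) g = c *: br f1 g + br f2 g;
    poisson_leibniz : forall f g h, br (f * g) h = f * br g h + br f h * g;
    poisson_jacobi : forall f g h,
      br (br f g) h + br (br g h) f + br (br h f) g = 0
  }.

(* The Schouten bracket [P, Q] of two bivector fields, viewed as
   skew-symmetric biderivations, is the trivector field whose value on three
   functions is, up to an overall sign convention, the sum over the
   (2,1)-shuffles of Q (P f g) h and P (Q f g) h; by skew-symmetry the shuffles
   are the cyclic permutations of (f, g, h).  [P, P] is twice the Jacobiator. *)
Definition schouten (K : fieldType) (A : comAlgType K)
    (P Q : A -> A -> A) (f g h : A) : A :=
  (Q (P f g) h + Q (P g h) f + Q (P h f) g)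
  + (P (Q f g) h + P (Q g h) f + P (Q h f) g).

(* The polynomial algebra on the dual of gl(m), in the m * m variables l_i^j. *)
Notation poly_gl K m := {mpoly K[m * m]}.

(* l_i^j: lower index first. *)
Definition lgen (K : fieldType) (m : nat) (i j : 'I_m) : poly_gl K m :=
  'X_(mxvec_index i j).

Definition dgen (K : fieldType) (m : nat) (i j : 'I_m) (f : poly_gl K m) :
    poly_gl K m :=
  mderiv (mxvec_index i j) f.

(* The unique derivation with value [X k s] on each generator l_k^s. *)
Definition vfield (K : fieldType) (m : nat) (X : 'I_m -> 'I_m -> poly_gl K m)
    (f : poly_gl K m) : poly_gl K m :=
  \sum_(k < m) \sum_(s < m) X k s * dgen k s f.

(* [lact i j f], [ract i j f] and [adact i j f] are the left, right and adjoint
   actions on f of the basis element e_i^j. *)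
Definition lact (K : fieldType) (m : nat) (i j : 'I_m) :
    poly_gl K m -> poly_gl K m :=
  vfield (fun k s => (k == j)%:R *: lgen K i s).

Definition ract (K : fieldType) (m : nat) (i j : 'I_m) :
    poly_gl K m -> poly_gl K m :=
  vfield (fun k s => (i == s)%:R *: lgen K k j).

Definition adact (K : fieldType) (m : nat) (i j : 'I_m) (f : poly_gl K m) :
    poly_gl K m :=
  lact i j f - ract i j f.

(* The unique biderivation with {l_i^j, l_k^r} = delta_k^j l_i^r - delta_i^r l_k^j. *)
Definition bracket_PL (K : fieldType) (m : nat) (f g : poly_gl K m) :
    poly_gl K m :=
  \sum_(i < m) \sum_(j < m) \sum_(k < m) \sum_(r < m)
    ((k == j)%:R *: lgen K i r - (i == r)%:R *: lgen K k j)
      * dgen i j f * dgen k r g.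

(* The next three maps already include the pointwise product applied to the
   tensors r_+^{l,r}(f (x) g), r_+^{r,l}(f (x) g) and r_-^{ad,ad}(f (x) g). *)
Definition mul_rplus_lr (K : fieldType) (m : nat) (f g : poly_gl K m) :
    poly_gl K m :=
  \sum_(i < m) \sum_(j < m) lact i j f * ract j i g.

Definition mul_rplus_rl (K : fieldType) (m : nat) (f g : poly_gl K m) :
    poly_gl K m :=
  \sum_(i < m) \sum_(j < m) ract i j f * lact j i g.

Definition mul_rminus_adad (K : fieldType) (m : nat) (f g : poly_gl K m) :
    poly_gl K m :=
  \sum_(i < m) \sum_(j < m | (i < j)%N)
    (adact i j f * adact j i g - adact j i f * adact i j g).

Definition bracket_r (K : fieldType) (m : nat) (f g : poly_gl K m) :
    poly_gl K m :=
  mul_rplus_lr f g - mul_rplus_rl f g - mul_rminus_adad f g.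

Definition bracket_PL_r (K : fieldType) (m : nat) (a b : K)
    (f g : poly_gl K m) : poly_gl K m :=
  a *: bracket_PL f g + b *: bracket_r f g.

(* Main.v *)
(** Write [F f] for the matrix of partial derivatives of f, transposed, and M
    for the matrix of coordinates.  The left and right fields are [M F] and
    [F M], the adjoint field is [ad f = [M, F f]].  The r_+ part of the bracket
    is [tr (M F G M) - tr (F M M G)] and is ad-invariant, so its Schouten
    bracket with the r_- part vanishes.  The Jacobiator of the r_+
    part is the trivector [tr (ad f ad g ad h) - tr (ad f ad h ad g)]; that of
    the r_- part is its opposite, by the modified Yang-Baxter equation, so the
    two cancel.

    All of this only uses [d_ij M_kl = delta_ik delta_jl], so it holds verbatim
    for the shifted matrix [M + c].  The shift leaves the adjoint fields
    unchanged and turns { , }_r into { , }_r - 2c { , }_PL; thus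
    { , }_r - 2c { , }_PL is Poisson for all c, and comparing c = 0, 1, -1 kills
    the three coefficients of the Jacobiator of the pencil. *)

Require Import Defs.
From mathcomp Require Import all_boot all_order all_algebra.
From mathcomp Require Import ring zify.

Set Implicit Arguments.
Unset Strict Implicit.
Unset Printing Implicit Defensive.

Import GRing.Theory.
Local Open Scope ring_scope.

(** * Cyclic sums, and derivations of a commutative ring *)

Definition cyclic_sum (A : nmodType) (T : A -> A -> A -> A) (f g h : A) : A :=
  T f g h + T g h f + T h f g.

Lemma sum_bool_pair (A : nmodType) (T : finType) (F : bool * T -> A) :
  \sum_p F p = \sum_q F (true, q) + \sum_q F (false, q).
Proof.
transitivity (\sum_b \sum_q F (b, q)); last by rewrite big_bool.
by rewrite pair_bigA; apply: eq_bigr; case.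
Qed.

Section Derivations.
Variable A : comNzRingType.

Definition derivation (D : A -> A) : Prop :=
  {morph D : x y / x + y} /\ forall x y, D (x * y) = D x * y + x * D y.

Lemma derivation0 D : derivation D -> D 0 = 0.
Proof. by case=> DD _; apply: (addIr (D 0)); rewrite -DD !add0r. Qed.

Lemma derivationN D : derivation D -> {morph D : x / - x}.
Proof.
move=> hD x; apply/eqP; rewrite -addr_eq0 -(proj1 hD) addNr.
by rewrite (derivation0 hD).
Qed.

Lemma derivationB D : derivation D -> {morph D : x y / x - y}.
Proof. by move=> hD x y; rewrite (proj1 hD) (derivationN hD). Qed.

Lemma derivation_sum D (I : Type) (r : seq I) (P : pred I) (F : I -> A) :
  derivation D -> D (\sum_(i <- r | P i) F i) = \sum_(i <- r | P i) D (F i).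
Proof.
by move=> hD; apply: (big_morph D (proj1 hD) (derivation0 hD)).
Qed.

Lemma derivation_nat D n : derivation D -> D n%:R = 0.
Proof.
move=> hD; elim: n => [|n IHn]; first exact: derivation0.
have D1 : D 1 = 0.
  by apply: (addIr (D 1)); rewrite add0r -{3}[1]mulr1 (proj2 hD) mulr1 mul1r.
by rewrite -addn1 natrD (proj1 hD) IHn D1 addr0.
Qed.

Lemma derivation_comb (I : finType) (c : I -> A) (D : I -> A -> A) :
  (forall i, derivation (D i)) -> derivation (fun x => \sum_i c i * D i x).
Proof.
move=> hD; split=> x y.
  by rewrite -big_split; apply: eq_bigr => i _; rewrite (proj1 (hD i)) mulrDr.
rewrite mulr_suml mulr_sumr -big_split; apply: eq_bigr => i _ /=.
rewrite (proj2 (hD i)); ring.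
Qed.

Lemma derivation_sub D E :
  derivation D -> derivation E -> derivation (fun x => D x - E x).
Proof.
move=> hD hE; split=> x y; first by rewrite (proj1 hD) (proj1 hE); ring.
by rewrite (proj2 hD) (proj2 hE); ring.
Qed.

Lemma eq_derivation (D E : A -> A) : D =1 E -> derivation E -> derivation D.
Proof. by move=> eDE [ED EM]; split=> x y; rewrite !eDE ?ED ?EM. Qed.

(** * Skew brackets assembled from vector fields with constant coefficients *)

Section SkewBracket.
Variables (I : finType) (V : I -> A -> A) (s : I -> A) (sigma : I -> I).
Hypothesis V_derivation : forall p, derivation (V p).
Hypothesis V_const : forall p q, V p (s q) = 0.
Hypothesis sigmaK : involutive sigma.
Hypothesis s_skew : forall p, s (sigma p) = - s p.

(** A bivector with legs [V p] and [V (sigma p)]: [sigma] exchanges the legs and [s] is odd under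
    it. The r_+ and r_- parts of the bracket both have this shape. *)
Definition skew_bracket (f g : A) : A :=
  \sum_p s p * (V p f * V (sigma p) g).

(** One of the three terms of the classical Yang-Baxter expression [[r12, r13] + [r12, r23] +
    [r13, r23]]: the one whose commutator falls on the first function. *)
Definition commutator_term (f g h : A) : A :=
  \sum_p \sum_q s p * s q *
    ((V q (V p f) - V p (V q f)) * V (sigma p) g * V (sigma q) h).

Lemma skew_bracketC f g : skew_bracket f g = - skew_bracket g f.
Proof.
rewrite /skew_bracket (reindex_inj (inv_inj sigmaK)) -sumrN.
by apply: eq_bigr => p _; rewrite s_skew sigmaK; ring.
Qed.

Lemma skew_bracket_derivation f : derivation (skew_bracket f).
Proof.
apply: (eq_derivation (E := fun g => \sum_p (s p * V p f) * V (sigma p) g)).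
  by move=> g; apply: eq_bigr => p _; rewrite mulrA.
by apply: derivation_comb.
Qed.

Lemma derivation_scale p q x : V p (s q * x) = s q * V p x.
Proof. by rewrite (proj2 (V_derivation p)) V_const mul0r add0r. Qed.

(** [V q] hits one of the two factors of the inner bracket; reindexing the second case along [sigma]
    turns it into minus the first with f and g exchanged. *)
Lemma skew_bracket_nested f g h :
  let T f g h := \sum_p \sum_q s p * s q *
    (V q (V p f) * V (sigma p) g * V (sigma q) h) in
  skew_bracket (skew_bracket f g) h = T f g h - T g f h.
Proof.
move=> T.
have -> : skew_bracket (skew_bracket f g) h = T f g h +
    \sum_p \sum_q s p * s q *
      (V p f * V q (V (sigma p) g) * V (sigma q) h).
  rewrite /T [X in X + _]exchange_big [X in _ + X]exchange_big -big_split.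
  apply: eq_bigr => q _; rewrite derivation_sum // mulr_suml mulr_sumr.
  rewrite -big_split; apply: eq_bigr => p _ /=.
  rewrite derivation_scale (proj2 (V_derivation q)); ring.
congr (_ + _); rewrite (reindex_inj (inv_inj sigmaK)) -sumrN.
apply: eq_bigr => p _; rewrite -sumrN; apply: eq_bigr => q _.
rewrite s_skew sigmaK; ring.
Qed.

(** The six second-order sums pair up as [T f g h - T f h g]; exchanging p and q in the subtracted
    sum leaves only commutators of fields. *)
Lemma skew_bracket_jacobiator f g h :
  cyclic_sum (fun f g h => skew_bracket (skew_bracket f g) h) f g h =
  cyclic_sum commutator_term f g h.
Proof.
pose T f g h := \sum_p \sum_q s p * s q *
    (V q (V p f) * V (sigma p) g * V (sigma q) h).
have K f' g' h' : commutator_term f' g' h' = T f' g' h' - T f' h' g'.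
  rewrite /commutator_term /T [X in _ - X]exchange_big -sumrB.
  apply: eq_bigr => p _; rewrite -sumrB; apply: eq_bigr => q _ /=; ring.
rewrite /cyclic_sum !skew_bracket_nested -!/(T _ _ _) !K; ring.
Qed.

(** Invariance carries [V p] inside [Q], so no derivative of a bracket is left: every term is a [U],
    and the twelve of them cancel in pairs over the cyclic sum. *)
Lemma skew_bracket_schouten (Q : A -> A -> A) f g h :
  (forall x, derivation (Q x)) -> (forall x y, Q x y = - Q y x) ->
  (forall p x y, V p (Q x y) = Q (V p x) y + Q x (V p y)) ->
  (forall x p y, Q x (s p * y) = s p * Q x y) ->
  cyclic_sum (fun f g h => skew_bracket (Q f g) h + Q (skew_bracket f g) h)
    f g h = 0.
Proof.
move=> hQ Qskew Qinv Qs.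
pose U f g h := \sum_p s p * (Q (V p f) g * V (sigma p) h).
have BQ f' g' h' : skew_bracket (Q f' g') h' = U f' g' h' - U g' f' h'.
  rewrite /skew_bracket /U -sumrB; apply: eq_bigr => p _.
  rewrite Qinv (Qskew f'); ring.
have QB f' g' h' : Q (skew_bracket f' g') h' = U f' h' g' - U g' h' f'.
  rewrite Qskew derivation_sum // -sumrN.
  rewrite /U [X in _ = _ - X](reindex_inj (inv_inj sigmaK)) -sumrB.
  apply: eq_bigr => p _.
  rewrite sigmaK s_skew Qs (proj2 (hQ h')) (Qskew h').
  rewrite (Qskew h' (V (sigma p) g')).
  ring.
rewrite /cyclic_sum !BQ !QB; ring.
Qed.

End SkewBracket.
End Derivations.

(** * Trace identities on gl(m) and the modified Yang-Baxter equation *)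

Section GlRepresentations.
Variables (A : comNzRingType) (m : nat).
Implicit Types X Y Z : 'M[A]_m.

(** The Cartan 3-form [tr (X [Y, Z])]. *)
Definition alt_trace X Y Z : A := \tr (X *m Y *m Z) - \tr (X *m Z *m Y).

Definition sgn_ord (i j : 'I_m) : A := (i < j)%N%:R - (j < i)%N%:R.

(** The standard R-operator attached to r_-: it is 1 on strictly upper triangular matrices, -1 on
    strictly lower ones and 0 on the diagonal. *)
Definition sgn_mx X : 'M[A]_m := \matrix_(i, j) (sgn_ord i j * X i j).

Lemma sgn_ordC i j : sgn_ord i j = - sgn_ord j i.
Proof. by rewrite /sgn_ord opprB. Qed.

Lemma derivation_sgn (D : A -> A) i j :
  derivation D -> D (sgn_ord i j) = 0.
Proof. by move=> hD; rewrite (derivationB hD) !derivation_nat // subr0. Qed.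

Lemma trace_mulmx2 X Y : \tr (X *m Y) = \sum_i \sum_j X i j * Y j i.
Proof. by apply: eq_bigr => i _; rewrite mxE. Qed.

Lemma trace_mulmx3 X Y Z :
  \tr (X *m Y *m Z) = \sum_i \sum_j \sum_k X i j * Y j k * Z k i.
Proof.
rewrite trace_mulmx2; apply: eq_bigr => i _; rewrite exchange_big.
by apply: eq_bigr => k _; rewrite mxE mulr_suml.
Qed.

Lemma trace_mulmxC3 X Y Z : \tr (X *m Y *m Z) = \tr (Y *m Z *m X).
Proof. by rewrite -mulmxA mxtrace_mulC. Qed.

Lemma alt_traceC X Y Z : alt_trace X Y Z = alt_trace Y Z X.
Proof.
by rewrite /alt_trace trace_mulmxC3 (trace_mulmxC3 Y X) (trace_mulmxC3 X Z).
Qed.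

Lemma trace_mulmx3B X X' Y Y' Z Z' :
  \tr ((X - X') *m (Y - Y') *m (Z - Z')) =
    \tr (X *m Y *m Z) - \tr (X' *m Y *m Z) - \tr (X *m Y' *m Z)
    - \tr (X *m Y *m Z') + \tr (X' *m Y' *m Z) + \tr (X' *m Y *m Z')
    + \tr (X *m Y' *m Z') - \tr (X' *m Y' *m Z').
Proof. rewrite !(mulmxBl, mulmxBr) !raddfB /=; ring. Qed.

Lemma sum_deltal (i : 'I_m) (F : 'I_m -> A) :
  \sum_j (j == i)%:R * F j = F i.
Proof.
rewrite (bigD1 i) //= eqxx mul1r big1 ?addr0 // => j /negbTE ->.
by rewrite mul0r.
Qed.

Lemma sum_deltar (i : 'I_m) (F : 'I_m -> A) :
  \sum_j (i == j)%:R * F j = F i.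
Proof.
by rewrite -[RHS]sum_deltal; apply: eq_bigr => j _; rewrite eq_sym.
Qed.

(** The first factor carries the structure constants of gl(m), so this evaluates [commutator_term]
    for fields that close into gl(m). *)
Lemma gl_commutator_sum X Y Z :
  \sum_(p : 'I_m * 'I_m) \sum_(q : 'I_m * 'I_m)
     ((p.1 == q.2)%:R * X q.1 p.2 - (q.1 == p.2)%:R * X p.1 q.2)
       * Y p.2 p.1 * Z q.2 q.1 = alt_trace X Y Z.
Proof.
transitivity (\sum_i \sum_j \sum_k \sum_l
   ((i == l)%:R * X k j - (k == j)%:R * X i l) * Y j i * Z l k).
  rewrite [RHS]pair_bigA; apply: eq_bigr => p _; rewrite [RHS]pair_bigA.
  by apply: eq_bigr.
transitivity (\sum_i \sum_j \sum_k X k j * Y j i * Z i k -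
   \sum_i \sum_j \sum_l X i l * Z l j * Y j i).
  rewrite -sumrB; apply: eq_bigr => i _; rewrite -sumrB; apply: eq_bigr => j _.
  transitivity (\sum_k \sum_l (i == l)%:R * (X k j * Y j i * Z l k) -
    \sum_k \sum_l (k == j)%:R * (X i l * Z l k * Y j i)).
    rewrite -sumrB; apply: eq_bigr => k _; rewrite -sumrB.
    by apply: eq_bigr => l _; ring.
  congr (_ - _); first by apply: eq_bigr => k _; rewrite sum_deltar.
  by rewrite exchange_big; apply: eq_bigr => l _; rewrite sum_deltal.
rewrite /alt_trace !trace_mulmx3; congr (_ - _).
  rewrite exchange_big /=.
  under eq_bigr => j _ do rewrite exchange_big.
  by rewrite exchange_big.
by apply: eq_bigr => i _; rewrite exchange_big.
Qed.

(** Around a triangle of distinct indices the three signs are never all equal, so their pairwise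
    products add up to -1. If exactly two indices coincide, one sign vanishes and the other two are
    opposite. *)
Lemma sgn_ord_triple (i j k : 'I_m) :
  sgn_ord i j * sgn_ord j k + sgn_ord j k * sgn_ord k i
    + sgn_ord k i * sgn_ord i j
  = (i == j)%:R * (j == k)%:R - 1.
Proof.
rewrite /sgn_ord -!val_eqE /=.
case: (ltngtP i j) => ij; case: (ltngtP j k) => jk; case: (ltngtP k i) => ki;
  rewrite /=; try (by ring); exfalso; lia.
Qed.

(** The modified Yang-Baxter equation for [sgn_mx] in trace form, entrywise from [sgn_ord_triple].
    The diagonal sum is symmetric in X, Y, Z and will disappear on antisymmetrizing. *)
Lemma sgn_trace X Y Z :
  \tr (X *m sgn_mx Y *m sgn_mx Z) + \tr (sgn_mx X *m Y *m sgn_mx Z)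
    + \tr (sgn_mx X *m sgn_mx Y *m Z)
  = \sum_i X i i * Y i i * Z i i - \tr (X *m Y *m Z).
Proof.
rewrite !trace_mulmx3 -!big_split -sumrB; apply: eq_bigr => i _ /=.
transitivity (\sum_j (i == j)%:R * \sum_k (j == k)%:R * (X i j * Y j k * Z k i)
   - \sum_j \sum_k X i j * Y j k * Z k i);
  last by rewrite sum_deltar sum_deltar.
rewrite -!big_split -sumrB; apply: eq_bigr => j _ /=.
rewrite mulr_sumr -!big_split -sumrB; apply: eq_bigr => k _ /=.
transitivity (((i == j)%:R * (j == k)%:R - 1) * (X i j * Y j k * Z k i));
  last by ring.
rewrite -sgn_ord_triple !mxE; ring.
Qed.

(** Under commutators with the fields of [P], the fields of [W] transform as the basis of the
    adjoint representation. *)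
Definition gl_equivariant (P W : A -> 'M[A]_m) : Prop :=
  forall i j k r f, P (W f k r) i j - W (P f i j) k r
    = (k == j)%:R * W f i r - (i == r)%:R * W f k j.

(** The trace form is ad-invariant: commuting a field of [P] past [X] and [Y] produces corrections
    that cancel inside the trace. *)
Lemma trace_equivariant (P X Y : A -> 'M[A]_m) :
  (forall i j, derivation (fun f => P f i j)) ->
  gl_equivariant P X -> gl_equivariant P Y ->
  forall i j f g, P (\tr (X f *m Y g)) i j
    = \tr (X (P f i j) *m Y g) + \tr (X f *m Y (P g i j)).
Proof.
move=> hP hX hY k l f g; rewrite !trace_mulmx2.
pose D := fun x => P x k l; rewrite -!/(D _).
have hD : derivation D by apply: hP.
have DX i j x : D (X x i j) =
    X (D x) i j + ((i == l)%:R * X x k j - (k == j)%:R * X x i l).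
  by rewrite -hX /D; ring.
have DY i j x : D (Y x i j) =
    Y (D x) i j + ((i == l)%:R * Y x k j - (k == j)%:R * Y x i l).
  by rewrite -hY /D; ring.
rewrite (derivation_sum _ _ _ hD).
under eq_bigr => i _ do rewrite (derivation_sum _ _ _ hD).
apply/eqP; rewrite -subr_eq0 opprD addrA -!sumrB; apply/eqP.
transitivity (\sum_i (i == l)%:R * (\sum_j X f k j * Y g j i)
   - \sum_i \sum_j (k == j)%:R * (X f i l * Y g j i)
   + (\sum_i \sum_j (j == l)%:R * (X f i j * Y g k i)
   - \sum_i (k == i)%:R * \sum_j (X f i j * Y g j l))).
  rewrite -!sumrB -big_split; apply: eq_bigr => i _ /=.
  rewrite !mulr_sumr -!sumrB -big_split; apply: eq_bigr => j _ /=.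
  rewrite (proj2 hD) DX DY; ring.
(* Once the deltas are collapsed, the first correction cancels the fourth and the second cancels the
   third. *)
rewrite sum_deltal sum_deltar.
under [X in _ - X + _]eq_bigr => i _ do rewrite sum_deltar.
under [X in _ + (X - _)]eq_bigr => i _ do rewrite sum_deltal.
ring.
Qed.

End GlRepresentations.

(** * Left, right and adjoint fields of a coordinate matrix, and their commutators *)

Section GradientFields.
Variables (A : comNzRingType) (m : nat) (M : 'M[A]_m).
Variable d : 'I_m -> 'I_m -> A -> A.
Hypothesis d_derivation : forall i j, derivation (d i j).
Hypothesis d_comm : forall i j k r f, d i j (d k r f) = d k r (d i j f).
Hypothesis d_coord : forall i j k r,
  d i j (M k r) = (k == i)%:R * (r == j)%:R.

Definition grad (f : A) : 'M[A]_m := \matrix_(i, j) d j i f.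
Definition lfield (f : A) : 'M[A]_m := M *m grad f.
Definition rfield (f : A) : 'M[A]_m := grad f *m M.
Definition adfield (f : A) : 'M[A]_m := lfield f - rfield f.

Lemma lfieldE f i j : lfield f i j = \sum_s M i s * d j s f.
Proof. by rewrite mxE; apply: eq_bigr => s _; rewrite mxE. Qed.

Lemma rfieldE f i j : rfield f i j = \sum_k M k j * d k i f.
Proof. by rewrite mxE; apply: eq_bigr => s _; rewrite mxE mulrC. Qed.

Lemma adfieldE f i j : adfield f i j = lfield f i j - rfield f i j.
Proof. by rewrite !mxE. Qed.

Lemma lfield_derivation i j : derivation (fun f => lfield f i j).
Proof.
exact: (eq_derivation (fun f => lfieldE f i j) (derivation_comb _ _)).
Qed.

Lemma rfield_derivation i j : derivation (fun f => rfield f i j).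
Proof.
exact: (eq_derivation (fun f => rfieldE f i j) (derivation_comb _ _)).
Qed.

Lemma adfield_derivation i j : derivation (fun f => adfield f i j).
Proof.
apply: (eq_derivation (fun f => adfieldE f i j)).
exact: derivation_sub (lfield_derivation i j) (rfield_derivation i j).
Qed.

(** The first-order term arises when the outer field differentiates a coordinate. The double sum is
    symmetric under exchange of the two fields, so it drops out of commutators. *)
Lemma lfield_lfield f i j k r :
  lfield (lfield f k r) i j = (k == j)%:R * lfield f i r
    + \sum_s \sum_t M i s * M k t * d j s (d r t f).
Proof.
rewrite lfieldE [in X in _ * X]lfieldE mulr_sumr -big_split.
apply: eq_bigr => s _ /=; rewrite lfieldE.
rewrite (derivation_sum _ _ _ (d_derivation j s)).
transitivity (M i s * ((k == j)%:R * \sum_t (t == s)%:R * d r t f)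
   + \sum_t M i s * M k t * d j s (d r t f)).
  rewrite !mulr_sumr -big_split; apply: eq_bigr => t _ /=.
  rewrite (proj2 (d_derivation j s)) d_coord; ring.
by rewrite sum_deltal mulrCA.
Qed.

Lemma rfield_rfield f i j k r :
  rfield (rfield f k r) i j = (i == r)%:R * rfield f k j
    + \sum_s \sum_t M s j * M t r * d s i (d t k f).
Proof.
rewrite rfieldE [in X in _ * X]rfieldE mulr_sumr -big_split.
apply: eq_bigr => s _ /=; rewrite rfieldE.
rewrite (derivation_sum _ _ _ (d_derivation s i)).
transitivity (M s j * ((i == r)%:R * \sum_t (t == s)%:R * d t k f)
   + \sum_t M s j * M t r * d s i (d t k f)).
  rewrite !mulr_sumr -big_split; apply: eq_bigr => t _ /=.
  rewrite (proj2 (d_derivation s i)) d_coord (eq_sym r); ring.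
by rewrite sum_deltal mulrCA.
Qed.

Lemma lfield_rfield f i j k r :
  lfield (rfield f k r) i j = M i r * d j k f
    + \sum_s \sum_t M i s * M t r * d j s (d t k f).
Proof.
rewrite lfieldE.
transitivity (\sum_s (r == s)%:R * (M i s * d j k f)
  + \sum_s \sum_t M i s * M t r * d j s (d t k f)); last by rewrite sum_deltar.
rewrite -big_split; apply: eq_bigr => s _ /=.
rewrite rfieldE (derivation_sum _ _ _ (d_derivation j s)).
transitivity ((r == s)%:R * (M i s * \sum_t (t == j)%:R * d t k f)
   + \sum_t M i s * M t r * d j s (d t k f)); last by rewrite sum_deltal.
rewrite !mulr_sumr -big_split; apply: eq_bigr => t _ /=.
rewrite (proj2 (d_derivation j s)) d_coord; ring.
Qed.

(** Left and right multiplications commute: both orders produce the same first-order term. *)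
Lemma rfield_lfield f i j k r :
  rfield (lfield f k r) i j = lfield (rfield f i j) k r.
Proof.
rewrite lfield_rfield rfieldE.
transitivity (\sum_s (k == s)%:R * (M s j * d r i f)
  + \sum_s \sum_t M k t * M s j * d r t (d s i f)).
  rewrite -big_split; apply: eq_bigr => s _ /=.
  rewrite lfieldE (derivation_sum _ _ _ (d_derivation s i)).
  transitivity ((k == s)%:R * (M s j * \sum_t (t == i)%:R * d r t f)
     + \sum_t M k t * M s j * d r t (d s i f)); last by rewrite sum_deltal.
  rewrite !mulr_sumr -big_split; apply: eq_bigr => t _ /=.
  rewrite (proj2 (d_derivation s i)) d_coord (d_comm s i); ring.
by rewrite sum_deltar; congr (_ + _); rewrite exchange_big.
Qed.

Lemma lfield_commutator i j k r f :
  lfield (lfield f k r) i j - lfield (lfield f i j) k r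
    = (k == j)%:R * lfield f i r - (i == r)%:R * lfield f k j.
Proof.
rewrite !lfield_lfield [X in _ - (_ + X)]exchange_big /=.
rewrite [X in _ - (_ + X)](_ : _ =
  \sum_s \sum_t M i s * M k t * d j s (d r t f)).
  ring.
apply: eq_bigr => s _; apply: eq_bigr => t _.
by rewrite (d_comm r t) (mulrC (M k t)).
Qed.

(** The sign is opposite to that of the left fields, because a right action reverses the order of
    composition. *)
Lemma rfield_commutator i j k r f :
  rfield (rfield f k r) i j - rfield (rfield f i j) k r
    = (i == r)%:R * rfield f k j - (k == j)%:R * rfield f i r.
Proof.
rewrite !rfield_rfield [X in _ - (_ + X)]exchange_big /=.
rewrite [X in _ - (_ + X)](_ : _ =
  \sum_s \sum_t M s j * M t r * d s i (d t k f)).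
  ring.
apply: eq_bigr => s _; apply: eq_bigr => t _.
by rewrite (d_comm t k) (mulrC (M t r)).
Qed.

Lemma lfield_equivariant : gl_equivariant adfield lfield.
Proof.
move=> i j k r f; rewrite adfieldE rfield_lfield -lfield_commutator.
rewrite [in X in _ - X = _]adfieldE (derivationB (lfield_derivation k r)); ring.
Qed.

(** The right fields enter [adfield] with a minus sign, which compensates the reversed sign of
    [rfield_commutator]. *)
Lemma rfield_equivariant : gl_equivariant adfield rfield.
Proof.
move=> i j k r f; rewrite adfieldE -rfield_lfield.
rewrite [in X in _ - X = _]adfieldE (derivationB (rfield_derivation k r)).
rewrite -[RHS]opprB -rfield_commutator; ring.
Qed.

Lemma adfield_commutator i j k r f :
  adfield (adfield f k r) i j - adfield (adfield f i j) k r
    = (k == j)%:R * adfield f i r - (i == r)%:R * adfield f k j.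
Proof.
rewrite (adfieldE f k r) (derivationB (adfield_derivation i j)).
rewrite (adfieldE (adfield f i j)) (adfieldE f i r) (adfieldE f k j).
transitivity (adfield (lfield f k r) i j - lfield (adfield f i j) k r
  - (adfield (rfield f k r) i j - rfield (adfield f i j) k r)); first by ring.
rewrite lfield_equivariant rfield_equivariant; ring.
Qed.

(** The Lie-Poisson bracket: by cyclicity of the trace it is the Kirillov-Kostant form [tr (M
    [grad g, grad f])]. *)
Definition lin_bracket (f g : A) : A := \tr (grad f *m adfield g).

Lemma lin_bracketC f g : lin_bracket f g = - lin_bracket g f.
Proof.
rewrite /lin_bracket /adfield /lfield /rfield !mulmxBr !raddfB /= !mulmxA.
rewrite (trace_mulmxC3 (grad f) M) (trace_mulmxC3 M (grad g)).
by rewrite (trace_mulmxC3 (grad g) M) (trace_mulmxC3 M (grad f)) opprK addrC.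
Qed.

(** Applied later to the scalars of the base field, this makes the brackets linear over it. *)
Lemma fields_const a : (forall i j, d i j a = 0) ->
  [/\ lfield a = 0, rfield a = 0 & adfield a = 0].
Proof.
move=> da; have ga : grad a = 0 by apply/matrixP => i j; rewrite !mxE.
by rewrite /adfield /lfield /rfield ga mulmx0 mul0mx subr0.
Qed.

Lemma lin_bracket_const f a : (forall i j, d i j a = 0) -> lin_bracket f a = 0.
Proof.
by case/fields_const => _ _ a0; rewrite /lin_bracket a0 mulmx0 linear0.
Qed.

Lemma lin_bracketE f g :
  lin_bracket f g = \sum_i \sum_j d i j f * adfield g i j.
Proof.
rewrite /lin_bracket trace_mulmx2 exchange_big; apply: eq_bigr => i _.
by apply: eq_bigr => j _; rewrite mxE.
Qed.

Lemma lin_bracket_derivation f : derivation (lin_bracket f).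
Proof.
apply: (eq_derivation (E := fun g => \sum_(p : 'I_m * 'I_m)
    d p.1 p.2 f * adfield g p.1 p.2)).
  by move=> g; rewrite lin_bracketE pair_bigA.
by apply: derivation_comb => p; exact: adfield_derivation.
Qed.

(** * The r_+ and r_- parts, their mixed Schouten bracket and their Jacobiators *)

Definition sym_bracket (f g : A) : A :=
  \tr (lfield f *m rfield g) - \tr (rfield f *m lfield g).

Definition asym_bracket (f g : A) : A :=
  \sum_i \sum_j sgn_ord A i j * (adfield f i j * adfield g j i).

Lemma sym_bracketC f g : sym_bracket f g = - sym_bracket g f.
Proof.
by rewrite /sym_bracket opprB mxtrace_mulC (mxtrace_mulC (rfield f)).
Qed.

Lemma sym_bracket_const f a : (forall i j, d i j a = 0) -> sym_bracket f a = 0.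
Proof.
case/fields_const => l0 r0 _.
by rewrite /sym_bracket l0 r0 !mulmx0 linear0 subr0.
Qed.

Lemma asym_bracket_const f a :
  (forall i j, d i j a = 0) -> asym_bracket f a = 0.
Proof.
case/fields_const => _ _ a0; rewrite /asym_bracket a0.
apply: big1 => i _; apply: big1 => j _.
by rewrite [X in _ * X]mulrC mxE mul0r mulr0.
Qed.

Let swap (p : 'I_m * 'I_m) := (p.2, p.1).

Let swapK : involutive swap. Proof. by case. Qed.

Let bool_swap (p : bool * ('I_m * 'I_m)) := (~~ p.1, swap p.2).

Let bool_swapK : involutive bool_swap.
Proof. by case=> b [i j]; rewrite /bool_swap /= negbK. Qed.

(** The boolean selects left or right fields. The partner of the left field (i, j) is the right
    field (j, i), and the sign separates the two r_+ terms. *)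
Let lr_field (p : bool * ('I_m * 'I_m)) f :=
  (if p.1 then lfield else rfield) f p.2.1 p.2.2.

Let lr_sign (p : bool * ('I_m * 'I_m)) : A := if p.1 then 1 else -1.

Let ad_field (p : 'I_m * 'I_m) f := adfield f p.1 p.2.

Let ad_sign (p : 'I_m * 'I_m) : A := sgn_ord A p.1 p.2.

Lemma sym_bracketE f g :
  sym_bracket f g = skew_bracket lr_field lr_sign bool_swap f g.
Proof.
rewrite /skew_bracket sum_bool_pair /sym_bracket !trace_mulmx2 !pair_bigA.
congr (_ + _); first by apply: eq_bigr => p _; rewrite mul1r.
by rewrite -sumrN; apply: eq_bigr => p _; rewrite mulN1r.
Qed.

Lemma asym_bracketE f g :
  asym_bracket f g = skew_bracket ad_field ad_sign swap f g.
Proof. by rewrite /asym_bracket pair_bigA. Qed.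

Let lr_derivation p : derivation (lr_field p).
Proof.
by case: p => [[] [i j]]; [apply: lfield_derivation | apply: rfield_derivation].
Qed.

Let lr_const p q : lr_field p (lr_sign q) = 0.
Proof.
have h : lr_field p 1 = 0 by apply: (derivation_nat 1).
rewrite /lr_sign; case: (q.1) => //.
by rewrite (derivationN (lr_derivation p)) h oppr0.
Qed.

Let lr_skew p : lr_sign (bool_swap p) = - lr_sign p.
Proof. by case: p => [[] p]; rewrite /lr_sign /= ?opprK. Qed.

Let ad_derivation p : derivation (ad_field p).
Proof. exact: adfield_derivation. Qed.

Let ad_const p q : ad_field p (ad_sign q) = 0.
Proof. exact: derivation_sgn. Qed.

Let ad_skew p : ad_sign (swap p) = - ad_sign p.
Proof. exact: sgn_ordC. Qed.

Lemma asym_bracketC f g : asym_bracket f g = - asym_bracket g f.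
Proof. by rewrite !asym_bracketE; exact: skew_bracketC. Qed.

Lemma sym_bracket_derivation f : derivation (sym_bracket f).
Proof.
by apply: (eq_derivation (sym_bracketE f)); apply: skew_bracket_derivation.
Qed.

Lemma asym_bracket_derivation f : derivation (asym_bracket f).
Proof.
by apply: (eq_derivation (asym_bracketE f)); apply: skew_bracket_derivation.
Qed.

Lemma sym_bracket_invariant i j f g :
  adfield (sym_bracket f g) i j
    = sym_bracket (adfield f i j) g + sym_bracket f (adfield g i j).
Proof.
rewrite (derivationB (adfield_derivation i j)).
rewrite (trace_equivariant adfield_derivation
  lfield_equivariant rfield_equivariant).
rewrite (trace_equivariant adfield_derivation
  rfield_equivariant lfield_equivariant).
rewrite /sym_bracket; ring.
Qed.

(** The legs of the r_- part are adjoint fields, under which the r_+ part is invariant, so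
    [skew_bracket_schouten] applies. *)
Lemma sym_asym_schouten f g h :
  cyclic_sum (fun f g h => asym_bracket (sym_bracket f g) h
    + sym_bracket (asym_bracket f g) h) f g h = 0.
Proof.
have inv p x y : ad_field p (sym_bracket x y)
    = sym_bracket (ad_field p x) y + sym_bracket x (ad_field p y).
  exact: sym_bracket_invariant.
have scale x p y : sym_bracket x (ad_sign p * y) = ad_sign p * sym_bracket x y.
  have hD := sym_bracket_derivation x.
  by rewrite (proj2 hD) derivation_sgn // mul0r add0r.
rewrite -(skew_bracket_schouten swapK ad_skew f g h sym_bracket_derivation
  sym_bracketC inv scale).
by rewrite /cyclic_sum !asym_bracketE.
Qed.

Lemma sym_bracket_jacobiator f g h :
  cyclic_sum (fun f g h => sym_bracket (sym_bracket f g) h) f g h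
    = alt_trace (adfield f) (adfield g) (adfield h).
Proof.
(* Left fields commute with right ones, so only pairs p, q on the same side contribute; their
   partners lie on the other side. *)
have K x y z : commutator_term lr_field lr_sign bool_swap x y z =
    alt_trace (lfield x) (rfield y) (rfield z)
    - alt_trace (rfield x) (lfield y) (lfield z).
  rewrite -!gl_commutator_sum /commutator_term sum_bool_pair -sumrN.
  congr (_ + _); apply: eq_bigr => p _; rewrite sum_bool_pair.
    rewrite [X in _ + X]big1 ?addr0 => [|q _].
      apply: eq_bigr => q _.
      by rewrite /lr_field /lr_sign /= lfield_commutator; ring.
    by rewrite /lr_field /lr_sign /= rfield_lfield subrr !mul0r mulr0.
  rewrite [X in X + _]big1 ?add0r => [|q _].
    rewrite -sumrN; apply: eq_bigr => q _.
    by rewrite /lr_field /lr_sign /= rfield_commutator; ring.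
  by rewrite /lr_field /lr_sign /= rfield_lfield subrr !mul0r mulr0.
(* By cyclicity [tr (F M F M F M)] can be cut on either side of [M]. Hence the two pure terms in the
   expansion of [adfield] as left minus right cancel. *)
have LR x y z : \tr (rfield x *m rfield y *m rfield z) =
    \tr (lfield x *m lfield y *m lfield z).
  by rewrite /rfield /lfield !mulmxA [LHS]mxtrace_mulC !mulmxA.
rewrite /cyclic_sum !sym_bracketE.
rewrite [LHS](skew_bracket_jacobiator lr_derivation lr_const
  bool_swapK lr_skew).
rewrite /cyclic_sum !K -(alt_traceC (rfield f) (lfield g)).
rewrite -(alt_traceC (lfield f) (rfield g)) (alt_traceC (lfield h)).
rewrite (alt_traceC (rfield h)) /alt_trace !trace_mulmx3B !LR; ring.
Qed.

Lemma asym_bracket_jacobiator f g h :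
  cyclic_sum (fun f g h => asym_bracket (asym_bracket f g) h) f g h
    = - alt_trace (adfield f) (adfield g) (adfield h).
Proof.
have K x y z : commutator_term ad_field ad_sign swap x y z =
    alt_trace (adfield x) (sgn_mx (adfield y)) (sgn_mx (adfield z)).
  rewrite -gl_commutator_sum /commutator_term.
  apply: eq_bigr => p _; apply: eq_bigr => q _.
  rewrite /ad_field /ad_sign /= adfield_commutator !mxE.
  (* The second legs sit at transposed indices, so [sgn_mx] supplies both signs reversed; the two
     reversals cancel. *)
  rewrite (sgn_ordC A p.1) (sgn_ordC A q.1); ring.
rewrite /cyclic_sum !asym_bracketE.
rewrite [LHS](skew_bracket_jacobiator ad_derivation ad_const swapK ad_skew).
rewrite /cyclic_sum !K.
rewrite -(alt_traceC (sgn_mx (adfield f))) (alt_traceC (adfield h)).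
rewrite /alt_trace.
(* The two cyclic orders of f, g, h give two Yang-Baxter identities; in their difference the
   diagonal sums cancel. *)
have E1 := sgn_trace (adfield f) (adfield g) (adfield h).
have E2 := sgn_trace (adfield f) (adfield h) (adfield g).
transitivity (\tr (adfield f *m sgn_mx (adfield g) *m sgn_mx (adfield h)) +
  \tr (sgn_mx (adfield f) *m adfield g *m sgn_mx (adfield h)) +
  \tr (sgn_mx (adfield f) *m sgn_mx (adfield g) *m adfield h) -
  (\tr (adfield f *m sgn_mx (adfield h) *m sgn_mx (adfield g)) +
  \tr (sgn_mx (adfield f) *m adfield h *m sgn_mx (adfield g)) +
  \tr (sgn_mx (adfield f) *m sgn_mx (adfield h) *m adfield g))); first by ring.
rewrite E1 E2 [in X in _ - (X - _)](eq_bigr (fun i =>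
  adfield f i i * adfield g i i * adfield h i i)); first by ring.
by move=> i _; rewrite mulrAC.
Qed.

(** * The full bracket and its Jacobi identity *)

Definition gl_bracket (f g : A) : A := sym_bracket f g - asym_bracket f g.

Lemma gl_bracketC f g : gl_bracket f g = - gl_bracket g f.
Proof. by rewrite /gl_bracket sym_bracketC asym_bracketC; ring. Qed.

Lemma gl_bracket_derivation f : derivation (gl_bracket f).
Proof.
exact: derivation_sub (sym_bracket_derivation f) (asym_bracket_derivation f).
Qed.

Lemma gl_bracket_const f a : (forall i j, d i j a = 0) -> gl_bracket f a = 0.
Proof.
move=> da; rewrite /gl_bracket sym_bracket_const //.
by rewrite asym_bracket_const // subr0.
Qed.

Lemma gl_bracket_jacobi f g h :
  cyclic_sum (fun f g h => gl_bracket (gl_bracket f g) h) f g h = 0.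
Proof.
have symB x y z : sym_bracket (x - y) z = sym_bracket x z - sym_bracket y z.
  rewrite !(sym_bracketC _ z) (derivationB (sym_bracket_derivation z)); ring.
have asymB x y z : asym_bracket (x - y) z = asym_bracket x z - asym_bracket y z.
  rewrite !(asym_bracketC _ z) (derivationB (asym_bracket_derivation z)); ring.
transitivity (cyclic_sum (fun f g h => sym_bracket (sym_bracket f g) h) f g h
  + cyclic_sum (fun f g h => asym_bracket (asym_bracket f g) h) f g h
  - cyclic_sum (fun f g h => asym_bracket (sym_bracket f g) h
      + sym_bracket (asym_bracket f g) h) f g h).
  rewrite /cyclic_sum /gl_bracket !(symB (sym_bracket _ _)).
  rewrite !(asymB (sym_bracket _ _)).
  ring.
rewrite (sym_bracket_jacobiator f g h) asym_bracket_jacobiator.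
rewrite sym_asym_schouten; ring.
Qed.

End GradientFields.

(** * Translation of the coordinate matrix by a scalar matrix *)

Section Shift.
Variables (A : comNzRingType) (m : nat) (M : 'M[A]_m) (c : A).
Variable d : 'I_m -> 'I_m -> A -> A.

Lemma lfield_shift f :
  lfield (M + c%:M) d f = lfield M d f + c *: grad d f.
Proof. by rewrite /lfield mulmxDl mul_scalar_mx. Qed.

Lemma rfield_shift f :
  rfield (M + c%:M) d f = rfield M d f + c *: grad d f.
Proof. by rewrite /rfield mulmxDr mul_mx_scalar. Qed.

Lemma adfield_shift f : adfield (M + c%:M) d f = adfield M d f.
Proof.
by rewrite /adfield lfield_shift rfield_shift opprD addrACA subrr addr0.
Qed.

Lemma asym_bracket_shift f g :
  asym_bracket (M + c%:M) d f g = asym_bracket M d f g.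
Proof. by rewrite /asym_bracket !adfield_shift. Qed.

(** The terms in [c * c] are [tr (grad f *m grad g)] in both traces and cancel. The four terms
    linear in c coincide in pairs by cyclicity, whence the factor [c + c]. *)
Lemma sym_bracket_shift f g :
  sym_bracket (M + c%:M) d f g
    = sym_bracket M d f g - (c + c) * lin_bracket M d f g.
Proof.
rewrite /sym_bracket /lin_bracket !lfield_shift !rfield_shift /adfield.
rewrite !(mulmxDl, mulmxDr, mulmxN) -!scalemxAl -!scalemxAr.
rewrite !raddfD !raddfN /= !mxtraceZ /lfield /rfield !mulmxA.
rewrite (trace_mulmxC3 M (grad d f)); ring.
Qed.

Lemma gl_bracket_shift f g :
  gl_bracket (M + c%:M) d f g
    = gl_bracket M d f g - (c + c) * lin_bracket M d f g.
Proof.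
by rewrite /gl_bracket sym_bracket_shift asym_bracket_shift addrAC.
Qed.

Lemma coord_shift i j k r :
  derivation (d i j) -> d i j c = 0 ->
  d i j ((M + c%:M) k r) = d i j (M k r).
Proof.
move=> hd dc; rewrite !mxE (proj1 hd) -mulr_natl (proj2 hd) dc mulr0 addr0.
by rewrite derivation_nat // mul0r addr0.
Qed.

End Shift.

(** * Linear pencils of skew biderivations *)

Section Pencil.
Variables (K : fieldType) (A : comAlgType K).

(** Turns scalings into products inside [A], so that [ring] can treat both at once. *)
Lemma scale_as_mul : exists e : K -> A, forall c x, c *: x = e c * x.
Proof. by exists (fun c => c%:A) => c x; rewrite mulr_algl. Qed.

Lemma derivation_alg_linear (D : A -> A) (c : K) x :
  derivation D -> D c%:A = 0 -> D (c *: x) = c *: D x.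
Proof.
by move=> hD Dc; rewrite -mulr_algl (proj2 hD) Dc mul0r add0r mulr_algl.
Qed.

(** The first argument is governed by skew-symmetry, and linearity over [K] is encoded as vanishing
    on scalars. *)
Definition skew_biderivation (br : A -> A -> A) : Prop :=
  [/\ forall f g, br f g = - br g f, forall f, derivation (br f) &
      forall f (c : K), br f c%:A = 0].

Variables (P Q : A -> A -> A).
Hypotheses (hP : skew_biderivation P) (hQ : skew_biderivation Q).
Variables a b : K.

Let pencil f g := a *: P f g + b *: Q f g.

Lemma skew_biderivation_pencil : skew_biderivation pencil.
Proof.
have [Psk Pder PZ] := hP; have [Qsk Qder QZ] := hQ.
split=> [f g|f|f c]; rewrite /pencil.
- by rewrite Psk Qsk !scalerN opprD.
- split=> x y.
    by rewrite (proj1 (Pder f)) (proj1 (Qder f)) !scalerDr addrACA.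
  rewrite (proj2 (Pder f)) (proj2 (Qder f)).
  have [e eE] := scale_as_mul; rewrite !eE; ring.
- by rewrite PZ QZ !scaler0 addr0.
Qed.

(** The Jacobiator is quadratic in the bracket, and its polarization is the Schouten bracket. *)
Lemma pencil_jacobiator f g h :
  cyclic_sum (fun f g h => pencil (pencil f g) h) f g h =
    a *: (a *: cyclic_sum (fun f g h => P (P f g) h) f g h
          + b *: schouten P Q f g h)
    + b *: (b *: cyclic_sum (fun f g h => Q (Q f g) h) f g h).
Proof.
have comb br : skew_biderivation br -> forall x y z,
    br (a *: x + b *: y) z = a *: br x z + b *: br y z.
  case=> sk der br1 x y z; rewrite sk (proj1 (der z)).
  rewrite (derivation_alg_linear x (der z) (br1 z a)).
  rewrite (derivation_alg_linear y (der z) (br1 z b)) opprD -!scalerN.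
  by rewrite -!(sk _ z).
rewrite /cyclic_sum /pencil /schouten !(comb _ hP) !(comb _ hQ).
have [e eE] := scale_as_mul; rewrite !eE; ring.
Qed.

Lemma skew_biderivation_poisson (br : A -> A -> A) :
  skew_biderivation br ->
  (forall f g h, cyclic_sum (fun f g h => br (br f g) h) f g h = 0) ->
  is_poisson br.
Proof.
case=> sk der br1 jac; split=> // [g c f1 f2|f g h].
  rewrite sk (proj1 (der g)) (derivation_alg_linear f1 (der g) (br1 g c)).
  by rewrite opprD -scalerN -!(sk _ g).
by rewrite sk (proj2 (der h)) (sk f h) (sk g h); ring.
Qed.

End Pencil.

(** * Identification with the brackets on the polynomial algebra of gl(m) *)

Section PolyGl.
Variables (K : fieldType) (m : nat).
Implicit Types (f g h : poly_gl K m) (c : K).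

Definition coord_mx : 'M[poly_gl K m]_m := \matrix_(i, j) lgen K i j.

Lemma dgen_derivation i j : derivation (@dgen K m i j).
Proof. by split=> x y; rewrite /dgen ?mderivD ?mderivM. Qed.

Lemma dgen_comm i j k r f : dgen i j (dgen k r f) = dgen k r (dgen i j f).
Proof. exact: mderiv_comm. Qed.

Lemma dgen_const i j c : dgen i j (c%:A : poly_gl K m) = 0.
Proof. by rewrite /dgen mderivZ -mpolyC1 mderivC scaler0. Qed.

Lemma mxvec_index_eq (i j k r : 'I_m) :
  (mxvec_index i j == mxvec_index k r) = (i == k) && (j == r).
Proof.
apply/eqP/andP => [|[/eqP -> /eqP ->] //].
by move=> /cast_ord_inj/enum_rank_inj [-> ->].
Qed.

Lemma dgen_coord i j k r :
  dgen i j (coord_mx k r) = (k == i)%:R * (r == j)%:R.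
Proof.
rewrite mxE /dgen /lgen mderivX mnm1E mxvec_index_eq.
case: eqP => [->|_] /=; last by rewrite scale0r mul0r.
case: eqP => [->|_] /=; last by rewrite scale0r mulr0.
rewrite (_ : (U_(_) - U_(_))%MM = 0%MM); first by rewrite mpolyX0 scale1r mulr1.
by apply/mnmP=> e; rewrite mnmBE mnm0E subnn.
Qed.

Lemma lactE i j f : lact i j f = \sum_s lgen K i s * dgen j s f.
Proof.
transitivity (\sum_k (k == j)%:R * \sum_s lgen K i s * dgen k s f).
  apply: eq_bigr => k _; rewrite mulr_sumr; apply: eq_bigr => s _.
  by rewrite scaler_nat -(mulr_natl (lgen _ _ _)) mulrA.
exact: sum_deltal.
Qed.

Lemma ractE i j f : ract i j f = \sum_k lgen K k j * dgen k i f.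
Proof.
apply: eq_bigr => k _.
transitivity (\sum_s (i == s)%:R * (lgen K k j * dgen k s f)).
  by apply: eq_bigr => s _; rewrite scaler_nat -(mulr_natl (lgen _ _ _)) mulrA.
exact: sum_deltar.
Qed.

Lemma lfield_coord i j f : lfield coord_mx (@dgen K m) f i j = lact i j f.
Proof. by rewrite lfieldE lactE; apply: eq_bigr => s _; rewrite mxE. Qed.

Lemma rfield_coord i j f : rfield coord_mx (@dgen K m) f i j = ract i j f.
Proof. by rewrite rfieldE ractE; apply: eq_bigr => s _; rewrite mxE. Qed.

Lemma adfield_coord i j f : adfield coord_mx (@dgen K m) f i j = adact i j f.
Proof.
rewrite adfieldE; congr (_ - _); [exact: lfield_coord | exact: rfield_coord].
Qed.

(** For fixed i, j the sum over k, r is the Hamiltonian field of [lgen K i j], that is, the adjoint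
    action of e_i^j on g. *)
Lemma bracket_PLE f g :
  bracket_PL f g = lin_bracket coord_mx (@dgen K m) f g.
Proof.
rewrite lin_bracketE; apply: eq_bigr => i _; apply: eq_bigr => j _.
rewrite adfield_coord mulrBr /lact /ract /vfield !mulr_sumr -sumrB.
apply: eq_bigr => k _.
rewrite !mulr_sumr -sumrB; apply: eq_bigr => r _.
rewrite !mulrA -!mulrBl; congr (_ * _); rewrite -mulrBr; exact: mulrC.
Qed.

Lemma mul_rminus_adadE f g : mul_rminus_adad f g =
  \sum_i \sum_j sgn_ord (poly_gl K m) i j * (adact i j f * adact j i g).
Proof.
pose t i j : poly_gl K m := adact i j f * adact j i g.
transitivity (\sum_(i < m) \sum_(j < m) (i < j)%N%:R * t i j
  - \sum_(i < m) \sum_(j < m) (j < i)%N%:R * t i j).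
  (* Renaming i and j in the second sum restores the condition i < j and yields the subtracted half
     of r_-. *)
  rewrite [X in _ - X]exchange_big -sumrB; apply: eq_bigr => i _.
  rewrite -sumrB big_mkcond; apply: eq_bigr => j _ /=; rewrite /t.
  by case: (i < j)%N => /=; ring.
rewrite -sumrB; apply: eq_bigr => i _; rewrite -sumrB; apply: eq_bigr => j _.
by rewrite /sgn_ord mulrBl.
Qed.

Lemma bracket_rE f g : bracket_r f g = gl_bracket coord_mx (@dgen K m) f g.
Proof.
congr (_ - _); last first.
  rewrite mul_rminus_adadE; apply: eq_bigr => i _; apply: eq_bigr => j _.
  by congr (_ * (_ * _)); rewrite adfield_coord.
congr (_ - _); apply: etrans (esym (trace_mulmx2 _ _)); apply: eq_bigr => i _;
  apply: eq_bigr => j _; congr (_ * _); apply: esym.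
- exact: lfield_coord.
- exact: rfield_coord.
- exact: rfield_coord.
- exact: lfield_coord.
Qed.

Lemma bracket_PL_biderivation : skew_biderivation (@bracket_PL K m).
Proof.
split=> [f g|f|f c].
- by rewrite !bracket_PLE; exact: lin_bracketC.
- apply: (eq_derivation (bracket_PLE f)).
  exact: lin_bracket_derivation dgen_derivation _.
- by rewrite bracket_PLE; apply: lin_bracket_const => i j; exact: dgen_const.
Qed.

Lemma bracket_r_biderivation : skew_biderivation (@bracket_r K m).
Proof.
split=> [f g|f|f c].
- by rewrite !bracket_rE; exact: gl_bracketC.
- apply: (eq_derivation (bracket_rE f)).
  exact: gl_bracket_derivation dgen_derivation _.
- by rewrite bracket_rE; apply: gl_bracket_const => i j; exact: dgen_const.
Qed.

(** This is the Jacobi identity of [gl_bracket] at the translated matrix. The coefficient 1 stays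
    visible so that the bracket has the form of a pencil. *)
Lemma bracket_r_shift_jacobi c f g h :
  let br x y := -(c + c) *: bracket_PL x y + 1 *: bracket_r x y in
  cyclic_sum (fun f g h => br (br f g) h) f g h = 0.
Proof.
move=> br; pose M := coord_mx + c%:MP%:M.
have brE x y : br x y = gl_bracket M (@dgen K m) x y.
  rewrite gl_bracket_shift -bracket_PLE -bracket_rE.
  by rewrite -mpolyCD mul_mpolyC /br scaleNr scale1r addrC.
have M_coord i j k r : dgen i j (M k r) = (k == i)%:R * (r == j)%:R.
  rewrite -dgen_coord; apply: coord_shift; first exact: dgen_derivation.
  exact: mderivC.
clearbody br; rewrite /cyclic_sum !brE.
exact: (gl_bracket_jacobi dgen_derivation dgen_comm M_coord).
Qed.

End PolyGl.

(** * Separation of the coefficients of the Jacobiator *)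

Theorem proposition34 (K : numFieldType) (m : nat) :
  (forall f g h : poly_gl K m,
     schouten (@bracket_PL K m) (@bracket_r K m) f g h = 0) /\
  (forall a b : K, is_poisson (@bracket_PL_r K m a b)).
Proof.
have hP := @bracket_PL_biderivation K m.
have hr := @bracket_r_biderivation K m.
pose JP := cyclic_sum (fun f g h => bracket_PL (@bracket_PL K m f g) h).
pose Jr := cyclic_sum (fun f g h => bracket_r (@bracket_r K m f g) h).
pose S := schouten (@bracket_PL K m) (@bracket_r K m).
(* The vanishing Jacobiator of the shifted bracket, expanded in the pencil coefficients [-(c + c)]
   and 1. *)
have J c f g h : -(c + c) *: (-(c + c) *: JP f g h + 1 *: S f g h)
    + 1 *: (1 *: Jr f g h) = 0.
  by rewrite -(pencil_jacobiator hP hr) bracket_r_shift_jacobi.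
have Jr0 f g h : Jr f g h = 0.
  by have := J 0 f g h; rewrite addr0 oppr0 scale0r add0r !scale1r.
(* Characteristic zero enters here, to divide by 2. *)
have two : (1 + 1 : K) != 0 by rewrite -(natrD _ 1 1) Num.Theory.pnatr_eq0.
have cancel2 x : (1 + 1 : K) *: x = 0 -> x = 0 :> poly_gl K m.
  by move/eqP; rewrite scaler_eq0 (negbTE two) => /eqP.
have J1 f g h : S f g h = (1 + 1 : K) *: JP f g h.
  have := J 1 f g h; rewrite Jr0 !scaler0 addr0 scale1r scaleNr.
  move/eqP; rewrite oppr_eq0 => /eqP /cancel2 /eqP.
  by rewrite scaleNr addrC subr_eq0 => /eqP.
have J2 f g h : S f g h = - ((1 + 1 : K) *: JP f g h).
  have := J (-1) f g h; rewrite Jr0 !scaler0 addr0 scale1r opprD opprK.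
  by move/cancel2/eqP; rewrite addrC addr_eq0 => /eqP.
(* The shifts 1 and -1 give [S] as twice [JP] and as minus twice [JP]; adding them, four times [JP]
   vanishes. *)
have JP0 f g h : JP f g h = 0.
  apply/cancel2/cancel2.
  by rewrite [LHS]scalerDl scale1r -[X in X + _]J1 J2 addNr.
have S0 f g h : S f g h = 0 by rewrite J1 JP0 scaler0.
split=> [//|a b].
apply: skew_biderivation_poisson; first exact: skew_biderivation_pencil.
move=> f g h; rewrite (pencil_jacobiator hP hr).
rewrite -/(JP f g h) -/(S f g h) -/(Jr f g h) JP0 S0 Jr0.
by rewrite !scaler0 !addr0 scaler0.
Qed.
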